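(* Let $G$ be a group and let $R$ be a $G$-graded ring. If $R$ has no zero divisors, then $(R,G)$ is weak if and only if $(R,G)$ is non-degenerate.
   Context: A ring $R$ with unity $1$ (not assumed commutative) is $G$-graded if $R=\bigoplus_{g\in G}R_g$ for additive subgroups $R_g$ with $R_gR_h\subseteq R_{gh}$ for all $g,h\in G$. $(R,G)$ is weak if for every $g\in G$, $R_g=\{0\}$ implies $R_{g^{-1}}=\{0\}$. $(R,G)$ is non-degenerate if for all $g\in G$ and all $a_g\in R_g\setminus\{0\}$ we have $a_gR_{g^{-1}}\neq\{0\}$ and $R_{g^{-1}}a_g\neq\{0\}$. *)

(* Defs.v *)
From mathcomp Require Import all_boot all_order all_algebra.
From mathcomp Require Import finmap mathcomp_extra boolp classical_sets.

Set Implicit Arguments.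
Unset Strict Implicit.
Unset Printing Implicit Defensive.

Import GRing.Theory.

Local Open Scope classical_set_scope.
Local Open Scope ring_scope.

(* Rings are [pzRingType]s: not necessarily commutative, and the zero ring is
   allowed. *)

(* R is the internal direct sum of the S i: every element is, in a unique way,
   a finitely supported sum of elements of the S i. *)
Definition direct_sum (I : choiceType) (R : zmodType) (S : I -> set R) : Prop :=
  forall r : R, exists! f : {fsfun I -> R with 0},
    (forall i, S i (f i)) /\ r = \sum_(i <- finsupp f) f i.

Record is_grading (G : groupType) (R : pzRingType) (S : G -> set R) : Prop :=
  IsGrading {
    grading_zmod : forall g, zmod_closed [in S g];
    grading_sum : direct_sum S;
    grading_mul : forall (g h : G) (a b : R),
      S g a -> S h b -> S (g * h)%g (a * b) }.

Definition weak_grading (G : groupType) (R : pzRingType)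
    (S : G -> set R) : Prop :=
  forall g : G, S g = [set 0] -> S (g^-1)%g = [set 0].

Definition nondegenerate_grading (G : groupType) (R : pzRingType)
    (S : G -> set R) : Prop :=
  forall (g : G) (a : R), (S g `\ 0) a ->
    [set a * b | b in S (g^-1)%g] <> [set 0] /\
    [set b * a | b in S (g^-1)%g] <> [set 0].

(* Main.v *)
Require Import Defs.
From mathcomp Require Import all_boot all_order all_algebra.
From mathcomp Require Import mathcomp_extra boolp classical_sets.

Import GRing.Theory.

Local Open Scope classical_set_scope.
Local Open Scope ring_scope.

(** Weakness, used at [g^-1], gives a nonzero [b] in [S g^-1] as soon as [S g] has a nonzero [a];
    without zero divisors, [a * b] and [b * a] are nonzero. Conversely, a nonzero element of
    [S g^-1] cannot have a nonzero product with [S g] when [S g] is zero. *)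

Lemma grading0 (G : groupType) (R : pzRingType) (S : G -> set R) (g : G) :
  is_grading S -> S g 0.
Proof. by move=> gradS; have [/set_mem] := grading_zmod gradS g. Qed.

Lemma neq_set10P (R : pzRingType) (A : set R) :
  A 0 -> A <> [set 0] -> exists2 b, A b & b <> 0.
Proof.
move=> A0 An0; apply: contrapT => noA; apply: An0.
apply/seteqP; split=> [b Ab|_ ->] //=.
by apply: contrapT => b0; apply: noA; exists b.
Qed.

Theorem proposition2p9 (G : groupType) (R : pzRingType) (S : G -> set R)
    (gradS : is_grading S) (domR : GRing.integral_domain_axiom R) :
  weak_grading S <-> nondegenerate_grading S.
Proof.
split=> [weakS g a [Sa a0]|nondegS g Sg0].
- have [b Sb b0] : exists2 b, S (g^-1)%g b & b <> 0.
    apply: neq_set10P; first exact: grading0.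
    (* If [S g^-1] were zero, so would be [S g], which contains [a]. *)
    move=> /weakS; rewrite invgK => Sg0.
    by apply: a0; rewrite Sg0 in Sa.
  have dom0 x y : x * y = 0 :> R -> x = 0 \/ y = 0.
    by move=> /domR/orP[] /eqP; [left|right].
  split=> /seteqP[sub0 _].
    by have /dom0[] : a * b = 0 by apply: sub0; exists b.
  by have /dom0[] : b * a = 0 by apply: sub0; exists b.
- apply: contrapT => Sgn0.
  have [a Sa a0] := neq_set10P _ _ (grading0 _ _ _ _ gradS) Sgn0.
  (* Nondegeneracy is taken at [g^-1], so the set multiplying [a] is [S g], here [[set 0]]. *)
  have [+ _] := nondegS _ _ (conj Sa a0).
  by rewrite invgK Sg0 image_set1 mulr0.
Qed.
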